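(* Let $k$ and $k'$ be nontrivial torus knots with groups $\pi k=\langle u,v\mid u^{p_1}=v^{p_2}\rangle$ and $\pi k'=\langle a,b\mid a^{r_1}=b^{r_2}\rangle$ such that $r_i\mid p_i$ ($i=1,2$). If $\phi:\pi k\to\pi k'$ is an epimorphism, then up to an automorphism of $\pi k'$ (that is, after replacing $\phi$ by its composition with some automorphism of $\pi k'$), we have $\phi(u)=a^{n_2}$ and $\phi(v)=c^{-1}b^{n_1}c$, where $n_ir_i=p_i$ ($i=1,2$) and $c=b^sa^t$ for some $s,t\in\mathbb{Z}$.
   Context: For a knot $k\subset\mathbb{S}^3$, $\pi k=\pi_1(\mathbb{S}^3\setminus k)$. The group of the $(p,q)$-torus knot is $\langle x,y\mid x^p=y^q\rangle$. When a knot is called a $(p,q)$-torus knot, it is always assumed that $p,q\ge2$ and $\gcd(p,q)=1$; thus here $k$ is the $(p_1,p_2)$-torus knot and $k'$ is the $(r_1,r_2)$-torus knot, with $p_1,p_2,r_1,r_2\ge 2$, $\gcd(p_1,p_2)=1$ and $\gcd(r_1,r_2)=1$. *)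

(* Defs.v *)
From HB Require Import structures.
From mathcomp Require Import all_boot all_order all_algebra.

Set Implicit Arguments.
Unset Strict Implicit.
Unset Printing Implicit Defensive.

Local Open Scope group_scope.

(* A word in the generators T and their formal inverses: (x, false) stands
   for x and (x, true) for the formal inverse of x. *)
Definition word (T : Type) := seq (T * bool).

Definition word_eval (T : Type) (G : groupType) (gen : T -> G) (w : word T) : G :=
  \prod_(l <- w) (if l.2 then (gen l.1)^-1 else gen l.1).

(* Equality of words in the group < T | w1 = w2 whenever R w1 w2 >: the least
   congruence on the free monoid of words that identifies x x^-1 and x^-1 x
   with the empty word, and w1 with w2 whenever R w1 w2. *)
Inductive pres_eq (T : Type) (R : word T -> word T -> Prop) :
    word T -> word T -> Prop :=
| pres_eq_refl w : pres_eq R w w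
| pres_eq_sym w1 w2 : pres_eq R w1 w2 -> pres_eq R w2 w1
| pres_eq_trans w1 w2 w3 : pres_eq R w1 w2 -> pres_eq R w2 w3 -> pres_eq R w1 w3
| pres_eq_cat w1 w1' w2 w2' :
    pres_eq R w1 w1' -> pres_eq R w2 w2' -> pres_eq R (w1 ++ w2) (w1' ++ w2')
| pres_eq_cancel x e : pres_eq R [:: (x, e); (x, ~~ e)] [::]
| pres_eq_rel w1 w2 : R w1 w2 -> pres_eq R w1 w2.

(* G = < gen | R >: evaluation of words induces a bijection (hence a group
   isomorphism) from words modulo pres_eq R onto G. *)
Definition is_presentation (T : Type) (R : word T -> word T -> Prop)
    (G : groupType) (gen : T -> G) : Prop :=
  (forall g : G, exists w : word T, word_eval gen w = g) /\
  (forall w1 w2 : word T,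
     word_eval gen w1 = word_eval gen w2 <-> pres_eq R w1 w2).

Inductive torus_gen : Type := TorusX | TorusY.

Definition torus_rel (p q : nat) (w1 w2 : word torus_gen) : Prop :=
  w1 = nseq p (TorusX, false) /\ w2 = nseq q (TorusY, false).

(* G = < x, y | x^p = y^q > *)
Definition torus_knot_presentation (p q : nat) (G : groupType) (x y : G) : Prop :=
  is_presentation (torus_rel p q)
    (fun i => match i with TorusX => x | TorusY => y end).

Definition is_torus_knot_type (p q : nat) : Prop :=
  [/\ (2 <= p)%N, (2 <= q)%N & coprime p q].

(* boot/monoid.v only has powers with a natural exponent. *)
Definition expgz (G : groupType) (x : G) (n : int) : G :=
  match n with
  | Posz m => x ^+ m
  | Negz m => x ^- m.+1
  end.

Definition surjective (A B : Type) (f : A -> B) : Prop :=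
  forall y : B, exists x : A, f x = y.

(* Main.v *)
(* In G = pi k', let z = a^r1 = b^r2; then G / <z> is the free product of
   cyclic groups of orders r1 and r2, whose elements are the alternating
   reduced words; the normal form is obtained by letting the generators act
   on such words. Since phi u^p1 = phi v^p2 commutes with the generators phi
   u and phi v, it is central, and an element with a central power is
   conjugate to a power of a or of b. The degree map G -> Z, a |-> r2, b |->
   r1, then shows that phi u is conjugate to a^(m n2) and phi v to b^(m n1)
   with m = 1 or m = -1, and a conjugation followed, if m = -1, by the
   automorphism a |-> a^-1, b |-> b^-1 reduces to phi u = a^n2 and phi v =
   c^-1 b^n1 c. Strip from the normal form of c a leading power of b and a
   trailing power of a. If a nontrivial word d remains, reduced words in a
   and d^-1 b d expand to reduced words none of which is b, contradicting
   that a and c^-1 b c generate G. *)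

Require Import Defs.
From HB Require Import structures.
From mathcomp Require Import all_boot all_order all_algebra.
From mathcomp Require Import zify.

Set Implicit Arguments.
Unset Strict Implicit.
Unset Printing Implicit Defensive.

Local Open Scope group_scope.

(** * Reduced words in a free product of two cyclic groups *)

Definition bool_of_torus_gen i := if i is TorusX then false else true.
Definition torus_gen_of_bool (b : bool) := if b then TorusY else TorusX.

Lemma bool_of_torus_genK : cancel bool_of_torus_gen torus_gen_of_bool.
Proof. by case. Qed.

HB.instance Definition _ :=
  Choice.copy torus_gen (can_type bool_of_torus_genK).

Definition letter := (torus_gen * nat)%type.

Section ReducedWords.

Variable r : torus_gen -> nat.
Hypothesis r_gt0 : forall t, 0 < r t.

Definition consr t k (s : seq letter) :=
  if k %% r t == 0 then s else (t, k %% r t) :: s.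

(** Left multiplication by the k-th power of the generator [t], acting on normal forms of the free
    product of cyclic groups of orders [r t]. *)
Definition mulL t k (s : seq letter) :=
  if s is (t', j) :: s' then
    if t' == t then consr t (k + j) s' else consr t k s
  else consr t k [::].

Definition head_neq t (s : seq letter) :=
  if s is l :: _ then l.1 != t else true.

Definition valid_letter (l : letter) := 0 < l.2 < r l.1.

Definition alternating := sorted (fun l m : letter => l.1 != m.1).

Definition reduced (s : seq letter) := all valid_letter s && alternating s.

Lemma reduced_cons l s :
  reduced (l :: s) = [&& valid_letter l, head_neq l.1 s & reduced s].
Proof.
rewrite /reduced /alternating; case: s => [|m s] //=; first by rewrite !andbT.
by rewrite (eq_sym m.1) -!andbA; do !bool_congr.
Qed.

Lemma reduced_cat s1 l s2 :
  reduced (rcons s1 l) -> reduced s2 -> head_neq l.1 s2 ->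
  reduced (rcons s1 l ++ s2).
Proof.
rewrite /reduced /alternating all_cat => /andP[-> s1P] /andP[-> s2P] ls2.
case: s2 s2P ls2 => [|m s2] /= s2P ls2; first by rewrite cats0.
case: s1 s1P => [|l' s1] /=; first by rewrite (eq_sym l.1) ls2.
by rewrite cat_path last_rcons /= (eq_sym l.1) ls2 => ->.
Qed.

Lemma reduced_catl s1 s2 : reduced (s1 ++ s2) -> reduced s1.
Proof.
rewrite /reduced /alternating all_cat => /andP[/andP[-> _]] /=.
by case: s1 => //= l s1; rewrite cat_path => /andP[].
Qed.

Lemma reduced_catr s1 s2 : reduced (s1 ++ s2) -> reduced s2.
Proof.
by elim: s1 => // l s1 IH; rewrite cat_cons reduced_cons => /and3P[_ _ /IH].
Qed.

Lemma reduced_consr t k s : head_neq t s -> reduced s -> reduced (consr t k s).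
Proof.
rewrite /consr; case: eqP => // /eqP k0 ts sP.
by rewrite reduced_cons ts sP /valid_letter /= ltn_mod r_gt0 lt0n k0.
Qed.

Lemma mulL_head_neq t k s : head_neq t s -> mulL t k s = consr t k s.
Proof. by case: s => // -[t' j] s /= /negPf ->. Qed.

Lemma mulL_consr t k l s :
  head_neq t s -> mulL t k (consr t l s) = consr t (k + l) s.
Proof.
move=> ts; rewrite {2}/consr -modnDmr {1}/consr.
case: eqP => [-> | _]; first by rewrite addn0 mulL_head_neq.
by rewrite /= eqxx.
Qed.

(** Allowing j = 0 treats words with and without a leading t-letter alike; in this form [mulL]
    merely adds exponents. *)
Lemma reducedP t s : reduced s ->
  exists j s', [/\ s = consr t j s', head_neq t s' & reduced s'].
Proof.
case: s => [|[t' j] s]; first by exists 0, [::]; rewrite /consr mod0n.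
case: (eqVneq t' t) => [-> | t't sP].
  rewrite reduced_cons => /and3P[/andP[j0 /= jr] ts sP]; exists j, s.
  by rewrite /consr modn_small // gtn_eqF.
by exists 0, ((t', j) :: s); rewrite /consr mod0n /= t't.
Qed.

Lemma reduced_mulL t k s : reduced s -> reduced (mulL t k s).
Proof.
case/(reducedP t) => j [s' [-> ts' s'P]].
by rewrite mulL_consr // reduced_consr.
Qed.

Lemma mulLD t k l s : reduced s -> mulL t k (mulL t l s) = mulL t (k + l) s.
Proof.
by case/(reducedP t) => j [s' [-> ts' s'P]]; rewrite !mulL_consr // addnA.
Qed.

Lemma mulL_modn t k s : reduced s -> k %% r t = 0 -> mulL t k s = s.
Proof.
case/(reducedP t) => j [s' [-> ts' s'P]] k0.
by rewrite mulL_consr // /consr -modnDml k0.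
Qed.

Lemma size_mulL_cons t k j s : size (mulL t k ((t, j) :: s)) <= (size s).+1.
Proof. by rewrite /= eqxx /consr; case: ifP. Qed.

End ReducedWords.

(** * Congruence modulo a central element *)

Section ModCentral.

Variables (G : groupType) (z : G).
Hypothesis z_central : forall g, commute z g.

(** Congruence modulo the subgroup generated by [z], the integer exponent being split into two
    natural ones. *)
Definition eqmodz (g h : G) := exists k l : nat, g * z ^+ k = h * z ^+ l.

Local Notation "g =~ h" := (eqmodz g h) (at level 70).

Lemma commuteXz k g : commute g (z ^+ k).
Proof. exact/commuteX/commute_sym. Qed.

Lemma eqmodz_refl g : g =~ g.
Proof. by exists 0, 0. Qed.

Lemma eqmodz_sym g h : g =~ h -> h =~ g.
Proof. by case=> k [l e]; exists l, k. Qed.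

Lemma eqmodz_trans h g f : g =~ h -> h =~ f -> g =~ f.
Proof.
case=> k [l e] [k' [l' e']]; exists (k + k'), (l + l').
by rewrite expgnDr mulgA e -mulgA -expgnDr addnC expgnDr mulgA e' -mulgA
  -expgnDr addnC.
Qed.

Lemma eqmodzM g g' h h' : g =~ g' -> h =~ h' -> g * h =~ g' * h'.
Proof.
case=> k [l e] [k' [l' e']]; exists (k + k'), (l + l').
rewrite !expgnDr -!mulgA (mulgA h) (commuteXz k h) -(mulgA _ h) e' mulgA e.
by rewrite -!mulgA (mulgA (z ^+ l)) -(commuteXz l h') !mulgA.
Qed.

Lemma eqmodzX g h n : g =~ h -> g ^+ n =~ h ^+ n.
Proof.
move=> e; elim: n => [|n IH]; first exact: eqmodz_refl.
by rewrite !expgS; apply: eqmodzM.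
Qed.

Lemma eqmodzJ g g' h : g =~ g' -> g ^ h =~ g' ^ h.
Proof.
move=> e; apply: eqmodzM; first exact: eqmodz_refl.
by apply: eqmodzM e _; exact: eqmodz_refl.
Qed.

Lemma conjg_eqmodz g h h' : h =~ h' -> g ^ h = g ^ h'.
Proof.
have Jz f k : g ^ (f * z ^+ k) = g ^ f.
  by rewrite conjgM /conjg (commuteXz k) mulKg.
by case=> k [l e]; rewrite -(Jz h k) e Jz.
Qed.

End ModCentral.

(** * Evaluation of words and homomorphisms out of a presented group *)

Section WordEval.

Variables (T : Type) (G : groupType) (gen : T -> G).

Lemma word_eval_nil : word_eval gen [::] = 1.
Proof. exact: big_nil. Qed.

Lemma word_eval_cons l w :
  word_eval gen (l :: w) =
    (if l.2 then (gen l.1)^-1 else gen l.1) * word_eval gen w.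
Proof. exact: big_cons. Qed.

Lemma word_eval_cat w1 w2 :
  word_eval gen (w1 ++ w2) = word_eval gen w1 * word_eval gen w2.
Proof. exact: big_cat. Qed.

Lemma word_eval_nseq k t : word_eval gen (nseq k (t, false)) = gen t ^+ k.
Proof.
elim: k => [|k IH]; first exact: word_eval_nil.
by rewrite word_eval_cons IH expgS.
Qed.

Lemma pres_eq_word_eval R :
    (forall w1 w2, R w1 w2 -> word_eval gen w1 = word_eval gen w2) ->
  forall w1 w2, pres_eq R w1 w2 -> word_eval gen w1 = word_eval gen w2.
Proof.
move=> RP w1 w2; elim=> {w1 w2} [//|w1 w2 _ //|w1 w2 w3 _ -> _ //| | |].
- by move=> w1 w1' w2 w2' _ e1 _ e2; rewrite !word_eval_cat e1 e2.
- move=> x [] /=; rewrite !word_eval_cons word_eval_nil mulg1 /=.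
    exact: mulVg.
  exact: mulgV.
- exact: RP.
Qed.

End WordEval.

Lemma commute_word_eval (T : Type) (G : groupType) (gen : T -> G) g w :
  (forall t, commute g (gen t)) -> commute g (word_eval gen w).
Proof.
move=> gC; elim: w => [|[t e] w IH].
  by rewrite word_eval_nil; exact: commute1.
rewrite word_eval_cons; apply: commuteM IH; case: e => //=.
exact: commuteV.
Qed.

Lemma word_eval_inv (T : Type) (G : groupType) (gen : T -> G) w :
  exists w', word_eval gen w' = (word_eval gen w)^-1.
Proof.
elim: w => [|[t e] w [w' IH]].
  by exists [::]; rewrite word_eval_nil invg1.
exists (w' ++ [:: (t, ~~ e)]); rewrite word_eval_cat IH !word_eval_cons invgM.
by rewrite word_eval_nil mulg1; case: e => //=; rewrite invgK.
Qed.

Lemma word_eval_subst (T T' : Type) (G : groupType) (gen : T -> G)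
    (gen' : T' -> G) :
    (forall t, exists w, gen' t = word_eval gen w) ->
  forall w', exists w, word_eval gen' w' = word_eval gen w.
Proof.
move=> gen'E; elim=> [|[t e] w' [w IH]].
  by exists [::]; rewrite !word_eval_nil.
have [w1 w1E] := gen'E t; have [w2 w2E] := word_eval_inv gen w1.
exists ((if e then w2 else w1) ++ w).
by rewrite word_eval_cat word_eval_cons IH /= w1E; case: e; rewrite ?w2E.
Qed.

Lemma eq_word_eval (T : Type) (G : groupType) (gen gen' : T -> G) w :
  gen =1 gen' -> word_eval gen w = word_eval gen' w.
Proof. by move=> e; apply: eq_bigr => l _; rewrite e. Qed.

Section Multiplicative.

Variables (G H : groupType) (f : G -> H).
Hypothesis fM : {morph f : g h / g * h}.

Lemma morph_group1 : f 1 = 1.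
Proof. by apply: (mulgI (f 1)); rewrite -fM !mulg1. Qed.

Lemma morph_groupV g : f g^-1 = (f g)^-1.
Proof. by apply: (mulgI (f g)); rewrite -fM !mulgV morph_group1. Qed.

Lemma morph_groupX g n : f (g ^+ n) = f g ^+ n.
Proof.
by elim: n => [|n IH]; rewrite ?expg0 ?morph_group1 // !expgS fM IH.
Qed.

Lemma morph_word_eval (T : Type) (gen : T -> G) w :
  f (word_eval gen w) = word_eval (f \o gen) w.
Proof.
elim: w => [|l w IH]; first by rewrite !word_eval_nil morph_group1.
by rewrite !word_eval_cons fM IH; case: l.2; rewrite ?morph_groupV.
Qed.

End Multiplicative.

(** The universal property of a presentation. A word is chosen for each element; [fP] shows that the
    value does not depend on the choice, which gives multiplicativity. *)
Lemma presentation_hom (T : choiceType) (R : word T -> word T -> Prop)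
    (G H : groupType) (gen : T -> G) (gen' : T -> H) :
    is_presentation R gen ->
    (forall w1 w2, R w1 w2 -> word_eval gen' w1 = word_eval gen' w2) ->
  exists2 f : G -> H, {morph f : g h / g * h} & forall t, f (gen t) = gen' t.
Proof.
case=> gen_surj gen_eq RP.
have word_of g : exists w : word T, word_eval gen w == g.
  by have [w <-] := gen_surj g; exists w.
have fP w g : word_eval gen w = g ->
    word_eval gen' (xchoose (word_of g)) = word_eval gen' w.
  move=> wg; apply: (pres_eq_word_eval RP); apply/gen_eq.
  by rewrite (eqP (xchooseP (word_of g))).
exists (fun g => word_eval gen' (xchoose (word_of g))) => [g h | t].
  rewrite -word_eval_cat; apply: fP.
  by rewrite word_eval_cat (eqP (xchooseP (word_of g)))
    (eqP (xchooseP (word_of h))).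
rewrite (@fP [:: (t, false)]) word_eval_cons word_eval_nil mulg1 //.
Qed.

Lemma expgz_sub (G : groupType) (g : G) (k l : nat) :
  expgz g (k%:Z - l%:Z)%R = g ^+ k / g ^+ l.
Proof.
case: (leqP l k) => [lk | kl].
  by rewrite subzn // /= expgnFr.
have -> : (k%:Z - l%:Z)%R = Negz (l - k).-1 by lia.
rewrite /= prednK ?subn_gt0 // expgnFr ?invgF //; exact: ltnW.
Qed.

(** * Evaluation of reduced words modulo z *)

Section Evaluation.

Variables (G : groupType) (z : G) (r : torus_gen -> nat) (x : torus_gen -> G).
Hypotheses (z_central : forall g, commute z g) (r_gt0 : forall t, 0 < r t).
Hypothesis x_r : forall t, x t ^+ r t = z.

Local Notation "g =~ h" := (eqmodz z g h) (at level 70).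

Definition evl (s : seq letter) : G := \prod_(l <- s) x l.1 ^+ l.2.

Lemma evl_nil : evl [::] = 1.
Proof. exact: big_nil. Qed.

Lemma evl_cons l s : evl (l :: s) = x l.1 ^+ l.2 * evl s.
Proof. exact: big_cons. Qed.

Lemma evl_cat s1 s2 : evl (s1 ++ s2) = evl s1 * evl s2.
Proof. exact: big_cat. Qed.

Lemma evl_rcons s l : evl (rcons s l) = evl s * x l.1 ^+ l.2.
Proof. by rewrite -cats1 evl_cat evl_cons evl_nil mulg1. Qed.

Lemma evl_consr t k s : evl (consr r t k s) =~ x t ^+ k * evl s.
Proof.
apply: eqmodz_sym; exists 0, (k %/ r t); rewrite mulg1 {1}(divn_eq k (r t)).
rewrite expgnDr mulnC expgnA x_r -mulgA -(commuteXz z_central).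
by rewrite /consr; case: eqP => [-> | _]; rewrite ?evl_cons // expg0 mul1g.
Qed.

Lemma evl_mulL t k s : evl (mulL r t k s) =~ x t ^+ k * evl s.
Proof.
case: s => [|[t' j] s] /=; first exact: evl_consr.
case: eqP => [-> | _]; last exact: evl_consr.
by rewrite evl_cons mulgA -expgnDr; exact: evl_consr.
Qed.

Lemma word_eval_reduced w : exists2 s, reduced r s & word_eval x w =~ evl s.
Proof.
elim: w => [|[t e] w [s sP IH]].
  by exists [::] => //; rewrite word_eval_nil evl_nil; exact: eqmodz_refl.
(* Modulo [z] the inverse of [x t] is its power with exponent [r t] - 1. *)
exists (mulL r t (if e then (r t).-1 else 1%N) s); first exact: reduced_mulL.
apply: eqmodz_trans (eqmodz_sym (evl_mulL _ _ _)).
rewrite word_eval_cons /=; apply: eqmodzM IH => //.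
case: e; last exact: eqmodz_refl.
exists 1%N, 0; rewrite expg1 mulg1 -(x_r t) -{1}(prednK (r_gt0 t)).
by rewrite expgS mulKg.
Qed.

End Evaluation.

(** * The action of the torus knot group on reduced words *)

Section TorusKnotGroup.

Variables (r : torus_gen -> nat) (G : groupType) (x : torus_gen -> G).
Hypothesis r_gt1 : forall t, 1 < r t.
Hypothesis x_pres : is_presentation (torus_rel (r TorusX) (r TorusY)) x.

Let r_gt0 t : 0 < r t.
Proof. exact: ltnW. Qed.

Let z := x TorusX ^+ r TorusX.

Local Notation "g =~ h" := (eqmodz z g h) (at level 70).

Lemma torus_gen_exp t : x t ^+ r t = z.
Proof.
case: t => //; rewrite /z -!word_eval_nseq; apply/x_pres.2.
by apply: pres_eq_sym; apply: pres_eq_rel.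
Qed.

Lemma torus_center g : commute z g.
Proof.
have zx t : commute z (x t).
  by rewrite -(torus_gen_exp t); apply/commute_sym/commuteX/commute_refl.
by have [w <-] := x_pres.1 g; exact: commute_word_eval.
Qed.

Definition act (w : word torus_gen) (s : seq letter) :=
  foldr (fun l s => mulL r l.1 (if l.2 then (r l.1).-1 else 1%N) s) s w.

Lemma reduced_act w s : reduced r s -> reduced r (act w s).
Proof. by move=> sP; elim: w => //= l w IH; apply: reduced_mulL. Qed.

Lemma act_cat w1 w2 s : act (w1 ++ w2) s = act w1 (act w2 s).
Proof. exact: foldr_cat. Qed.

Lemma act_nseq t k s : reduced r s -> act (nseq k (t, false)) s = mulL r t k s.
Proof.
move=> sP; elim: k => [|k IH] /=; first by rewrite mulL_modn ?mod0n.
by rewrite IH mulLD.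
Qed.

(** The exponents of a letter and its formal inverse add up to [r t], and both sides of the relation
    act trivially, so the action factors through the group. *)
Lemma pres_eq_act w1 w2 s :
  pres_eq (torus_rel (r TorusX) (r TorusY)) w1 w2 -> reduced r s ->
  act w1 s = act w2 s.
Proof.
move=> e; elim: e s => {w1 w2} [//|w1 w2 _ IH s sP||||].
- by rewrite IH.
- by move=> w1 w2 w3 _ e1 _ e2 s sP; rewrite e1 // e2.
- move=> w1 w1' w2 w2' _ e1 _ e2 s sP.
  by rewrite !act_cat (e2 s sP) e1 //; apply: reduced_act.
- move=> t e s sP /=; rewrite mulLD // mulL_modn //.
  by case: e; rewrite /= ?addn1 ?add1n prednK // modnn.
- by move=> _ _ [-> ->] s sP; rewrite !act_nseq // !mulL_modn // modnn.
Qed.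

Definition word_of_letters (s : seq letter) : word torus_gen :=
  flatten [seq nseq l.2 (l.1, false) | l <- s].

Lemma word_eval_of_letters s : word_eval x (word_of_letters s) = evl x s.
Proof.
elim: s => [|l s IH]; first by rewrite evl_nil word_eval_nil.
by rewrite evl_cons -IH -word_eval_nseq -word_eval_cat.
Qed.

Lemma act_word_of_letters s : reduced r s -> act (word_of_letters s) [::] = s.
Proof.
elim: s => // -[t j] s IH; rewrite reduced_cons => /and3P[/andP[j0 jr] ts sP].
rewrite act_cat IH // act_nseq // mulL_head_neq // /consr /=.
by rewrite modn_small // gtn_eqF.
Qed.

(* The normal form theorem for the free product of cyclic groups G / <z>. *)
Lemma evl_inj s s' :
  reduced r s -> reduced r s' -> evl x s =~ evl x s' -> s = s'.
Proof.
move=> sP s'P [k [l e]].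
have zE n : z ^+ n = word_eval x (nseq (r TorusX * n) (TorusX, false)).
  by rewrite word_eval_nseq expgnA.
(* Powers of [z] act trivially, so acting on the empty word recovers a reduced word from its class
   modulo [z]. *)
have actz n : act (nseq (r TorusX * n) (TorusX, false)) [::] = [::].
  by rewrite act_nseq // mulL_modn // modnMr.
move: e; rewrite !zE -!word_eval_of_letters -!word_eval_cat => /x_pres.2 e.
by have := pres_eq_act e (isT : reduced r [::]);
  rewrite !act_cat !actz !act_word_of_letters.
Qed.


Let z_central := torus_center.
Let x_r := torus_gen_exp.

(** * Elements with a central power *)

Lemma reduced_power t s i j n :
    1 < r t -> reduced r (rcons ((t, i) :: s) j) -> j.1 != t ->
  reduced r (flatten (nseq n (rcons ((t, i) :: s) j)) ++ [:: (t, 1%N)]).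
Proof.
move=> rt sP jt; elim: n => [|n IH].
  by rewrite reduced_cons /valid_letter /= rt.
rewrite /= -catA -cat_cons -rcons_cons; apply: reduced_cat IH _ => //.
by case: n => /=; rewrite eq_sym.
Qed.

Lemma evl_power s n : evl x (flatten (nseq n s)) = evl x s ^+ n.
Proof.
by elim: n => [|n IH]; rewrite ?evl_nil //= evl_cat IH expgS.
Qed.

(** Torsion in a free product is conjugate into a factor. The induction on the length of the word is
    a cyclic reduction. *)
Lemma torsion_mod_center s g n :
    reduced r s -> g =~ evl x s -> 0 < n -> (forall h, commute (g ^+ n) h) ->
  exists h t i, g =~ (x t ^+ i) ^ h.
Proof.
move=> sP gs n0 gn; have [m] := ubnP (size s).
elim: m s g sP gs gn => // m IH [|[t i] s] g sP gs gn ms.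
  by exists 1, TorusX, 0; move: gs; rewrite conjg1 evl_nil.
have [s0|[q [[t' j] def_s]]] : s = [::] \/ exists q l, s = rcons q l.
- by case/lastP: (s) => [|q l]; [left | right; exists q, l].
- exists 1, t, i; rewrite conjg1; move: gs.
  by rewrite s0 evl_cons evl_nil mulg1.
have [tt'|tt'] := eqVneq t' t.
(* Conjugating by the last letter merges it with the first one. *)
- pose y := x t ^- j.
  have gy : g ^ y =~ evl x (mulL r t j ((t, i) :: q)).
    apply: eqmodz_trans _ (eqmodz_sym (evl_mulL z_central x_r _ _ _)).
    apply: eqmodz_trans (eqmodzJ z_central y gs) _.
    rewrite def_s -rcons_cons evl_rcons tt' /= /conjg invgK mulgK.
    exact: eqmodz_refl.
  have [|||h [t1 [k gh]]] := IH _ _ _ gy.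
  + apply: reduced_mulL => //; apply: (@reduced_catl _ _ [:: (t', j)]).
    by rewrite cats1 rcons_cons -def_s.
  + move=> h; rewrite -conjXg (_ : _ ^ y = g ^+ n) //.
    by rewrite /conjg (gn y) mulKg.
  + apply: leq_ltn_trans (size_mulL_cons _ _ _ _ _) _.
    by move: ms; rewrite def_s /= size_rcons !ltnS.
  exists (h * y^-1), t1, k; rewrite conjgM -[g](conjgK y).
  exact: eqmodzJ.
(* Otherwise all powers of [(t, i) :: s] are reduced, hence not central. *)
- have := reduced_power n (r_gt1 t).
  move=> /(_ q i (t', j)); rewrite rcons_cons -def_s => /(_ sP tt') powP.
  have gnE : g ^+ n =~ evl x (flatten (nseq n ((t, i) :: s))).
    by rewrite evl_power; apply: eqmodzX.
  (* Since g^n commutes with [x t], multiplying its word by [x t] on either side gives congruent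
     elements. On the left the letter merges and the length does not grow; on the right it grows by
     one. *)
  have e : evl x (mulL r t 1 (flatten (nseq n ((t, i) :: s)))) =~
           evl x (flatten (nseq n ((t, i) :: s)) ++ [:: (t, 1%N)]).
    apply: eqmodz_trans (evl_mulL z_central x_r _ _ _) _.
    rewrite evl_cat evl_cons evl_nil mulg1 /= expg1.
    have {}gnE := eqmodz_sym gnE.
    apply: eqmodz_trans (eqmodzM z_central (eqmodz_refl _ _) gnE) _.
    rewrite -(gn (x t)); apply: eqmodzM (eqmodz_sym gnE) _ => //.
    exact: eqmodz_refl.
  have := evl_inj (reduced_mulL r_gt0 _ _ (reduced_catl powP)) powP e.
  move/(congr1 size); rewrite size_cat addn1.
  case: (n) n0 => // n' _ /=.
  have := size_mulL_cons r t 1 i (s ++ flatten (nseq n' ((t, i) :: s))).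
  by rewrite /= => + eq_size; rewrite eq_size ltnn.
Qed.

(** * Conjugates of b that generate the group together with a *)

(** The inverse modulo [z]; replacing -j by [r t] - j keeps the exponents in the range allowed in
    reduced words. *)
Definition invl (s : seq letter) : seq letter :=
  rev [seq (l.1, r l.1 - l.2) | l <- s].

Lemma invl_cons l s : invl (l :: s) = rcons (invl s) (l.1, r l.1 - l.2).
Proof. by rewrite /invl /= rev_cons. Qed.

Lemma invl_rcons l s : invl (rcons s l) = (l.1, r l.1 - l.2) :: invl s.
Proof. by rewrite /invl map_rcons rev_rcons. Qed.

Lemma reduced_invl s : reduced r s -> reduced r (invl s).
Proof.
rewrite /reduced /alternating /invl all_rev all_map rev_sorted sorted_map.
case/andP=> sP salt; apply/andP; split.
  move: sP; apply: sub_all => l /andP[l0 lr].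
  by rewrite /= /valid_letter /= subn_gt0 lr ltn_subrL l0 r_gt0.
by move: salt; apply: sub_sorted => l m /=; rewrite eq_sym.
Qed.

Lemma evl_invl s : reduced r s -> evl x (invl s) =~ (evl x s)^-1.
Proof.
elim: s => [|[t j] s IH].
  by rewrite evl_nil invg1 => _; exact: eqmodz_refl.
rewrite reduced_cons => /and3P[/andP[_ /= jr] _ /IH sV].
rewrite invl_cons evl_rcons evl_cons invgM; apply: eqmodzM sV _ => //=.
exists 0, 1%N; rewrite mulg1 expg1 -(x_r t) -[in RHS](subnKC (ltnW jr)).
by rewrite expgnDr mulKg.
Qed.

(* Rewriting the Y-letters of a reduced word as conjugates under c involves no
   cancellation when c starts with an X-letter and ends with a Y-letter. *)
Section Substitution.

Variable c : seq letter.

Definition expand_conj (s : seq letter) : seq letter :=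
  flatten [seq if l.1 is TorusX then [:: l] else invl c ++ l :: c | l <- s].

Definition conj_gen i := if i is TorusX then x TorusX else x TorusY ^ evl x c.

Hypothesis c_reduced : reduced r c.

(** Conjugation fixes the central [z], so [word_eval_reduced] also applies to the generators
    [conj_gen]. *)
Lemma conj_gen_exp t : conj_gen t ^+ r t = z.
Proof.
case: t => //=; rewrite -conjXg x_r.
by rewrite /conjg z_central mulKg.
Qed.

Lemma evl_expand_conj s : evl conj_gen s =~ evl x (expand_conj s).
Proof.
elim: s => [|[t j] s IH]; first by rewrite !evl_nil; exact: eqmodz_refl.
rewrite evl_cons evl_cat; apply: eqmodzM IH => //=.
case: t; first by rewrite evl_cons evl_nil mulg1; exact: eqmodz_refl.
rewrite evl_cat evl_cons /= -conjXg; apply: eqmodzM => //.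
  exact/eqmodz_sym/evl_invl.
exact: eqmodz_refl.
Qed.

(** Each block [invl c ++ l :: c] begins and ends with a Y-letter, so it meets its neighbours as the
    single letter [l] would. The clause on heads carries the induction. *)
Lemma reduced_expand_conj l0 q0 q1 l1 s :
    c = l0 :: q0 -> l0.1 = TorusX -> c = rcons q1 l1 -> l1.1 = TorusY ->
    reduced r s ->
  reduced r (expand_conj s) /\
  forall t, head_neq t (expand_conj s) = head_neq t s.
Proof.
move=> c0 l0X c1 l1Y; elim: s => [//|[t j] s IH].
rewrite reduced_cons => /and3P[lP /= ls /IH[sP hs]].
rewrite /expand_conj /= -/(expand_conj s); case: t lP ls => lP ls.
  by split=> //; rewrite /= reduced_cons lP /= hs ls.
split=> [|t]; last by rewrite {1}c1 invl_rcons /= l1Y.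
have /andP[cP c2P] : reduced r (invl c) && reduced r c.
  by rewrite reduced_invl.
rewrite -catA {1}c0 invl_cons; apply: reduced_cat.
- by rewrite -invl_cons -c0.
- rewrite /= reduced_cons lP {1}c0 /= l0X /= c1; apply: reduced_cat => //.
    by rewrite -c1.
  by rewrite l1Y hs.
- by rewrite /= l0X.
Qed.

End Substitution.

(** Brings a conjugator into the shape required by the substitution: the stripped power of b
    commutes with b, and that of a with a. *)
Lemma reduced_strip s : reduced r s -> exists i j s0,
  [/\ evl x s = x TorusY ^+ i * evl x s0 * x TorusX ^+ j, reduced r s0 &
      s0 = [::] \/ exists l0 q0 q1 l1,
        [/\ s0 = l0 :: q0, l0.1 = TorusX, s0 = rcons q1 l1 & l1.1 = TorusY]].
Proof.
move=> sP; have [i [s1 [-> s1P hs1]]] : exists i s1,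
    [/\ evl x s = x TorusY ^+ i * evl x s1, reduced r s1 & head_neq TorusY s1].
  case: s sP => [|[[] i] s] sP; first by exists 0, [::]; rewrite mul1g.
    by exists 0, ((TorusX, i) :: s); rewrite mul1g.
  move: sP; rewrite reduced_cons => /and3P[_ hs sP].
  by exists i, s; rewrite evl_cons.
have [j [s0 [-> s0P hs0 ls0]]] : exists j s0,
    [/\ evl x s1 = evl x s0 * x TorusX ^+ j, reduced r s0, head_neq TorusY s0 &
        s0 = [::] \/ exists q l, s0 = rcons q l /\ l.1 = TorusY].
  case/lastP: s1 s1P hs1 => [|q [[] j]] qP hq.
  - by exists 0, [::]; split=> //; [rewrite mulg1 | left].
  - exists j, q; have qP' : reduced r q.
      by apply: (@reduced_catl _ _ [:: (TorusX, j)]); rewrite cats1.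
    split=> //; rewrite ?evl_rcons //; first by case: (q) hq.
    case/lastP: q qP {hq qP'} => [|q [[] k]] qP; first by left.
      move: qP; rewrite -!cats1 -catA => /reduced_catr.
      by rewrite reduced_cons /= andbF.
    by right; exists q, (TorusY, k).
  - exists 0, (rcons q (TorusY, j)); split=> //; first by rewrite mulg1.
    by right; exists q, (TorusY, j).
exists i, j, s0; split=> //; first by rewrite mulgA.
case: ls0 => [|[q1 [l1 [s0E l1Y]]]]; [by left | right].
case: (s0) hs0 s0E => [_ /(congr1 size)|l0 q0 /= l0Y s0E].
  by rewrite size_rcons.
by exists l0, q0, q1, l1; split=> //; case: l0.1 l0Y.
Qed.

Lemma conj_generators c :
    (forall g, exists w, g = word_eval
       (fun i => if i is TorusX then x TorusX else x TorusY ^ c) w) ->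
  exists i j, c =~ x TorusY ^+ i * x TorusX ^+ j.
Proof.
move=> gen_c; have [w wE] := x_pres.1 c.
have [s sP] := word_eval_reduced z_central r_gt0 x_r w; rewrite wE => ws.
have [i [j [s0 [sE s0P s0end]]]] := reduced_strip sP.
exists i, j; apply: (eqmodz_trans ws); rewrite sE.
case: s0end => [-> | [l0 [q0 [q1 [l1 [c0 l0X c1 l1Y]]]]]].
  by rewrite evl_nil mulg1; exact: eqmodz_refl.
(* Conjugating by the inverse of the stripped power of a fixes a and turns the conjugate of b under
   [c] into its conjugate under [s0]. *)
have gen_s0 g : exists w', g = word_eval (conj_gen s0) w'.
  have [w' gE] := gen_c (g ^ (x TorusX ^+ j)); exists w'.
  rewrite -[g](conjgK (x TorusX ^+ j)) gE.
  rewrite (morph_word_eval (fun g h => conjMg g h _)).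
  apply: eq_word_eval => -[] /=.
    by rewrite /conjg invgK mulgA -expgSr expgS mulgK.
  rewrite (conjg_eqmodz z_central _ ws) sE -mulgA !conjgM conjgK.
  congr (_ ^ _); rewrite /conjg.
  by rewrite -expgS expgSr mulKg.
have [w' bE] := gen_s0 (x TorusY).
have [s1 s1P ws1] :=
  word_eval_reduced z_central r_gt0 (conj_gen_exp s0) w'.
have [subP subH] := reduced_expand_conj s0P c0 l0X c1 l1Y s1P.
have bP : reduced r [:: (TorusY, 1%N)].
  by rewrite reduced_cons /valid_letter /= r_gt1.
have : evl x [:: (TorusY, 1%N)] =~ evl x (expand_conj s0 s1).
  rewrite evl_cons evl_nil mulg1 /= expg1 bE.
  by apply: eqmodz_trans ws1 _; apply: evl_expand_conj.
move/(evl_inj bP subP) => subE; exfalso.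
(* Expansion preserves the type of the first letter, so [s1] starts with a Y-letter; as [s0] is
   nonempty, its block is longer than the one-letter word of b. *)
case: s1 subE subH {s1P ws1 subP} => [//|[[] k] s1] subE subH.
  by move: (subH TorusX); rewrite -subE.
move/(congr1 size): subE; rewrite /expand_conj /= !size_cat /= c0 /=; lia.
Qed.


(** * Lifting from the quotient by z to the group; degree and inversion *)

Lemma torsion_conj g n :
    0 < n -> (forall h, commute (g ^+ n) h) ->
  exists h t e, g = expgz (x t) e ^ h.
Proof.
move=> n0 gn; have [w wE] := x_pres.1 g.
have [s sP] := word_eval_reduced z_central r_gt0 x_r w; rewrite wE => gs.
have [h [t [i [k [l gE]]]]] := torsion_mod_center sP gs n0 gn.
(* The central correction is itself a power of [x t], since [z] is [x t] to the power [r t], and is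
   absorbed into the exponent. *)
exists h, t, ((i + r t * l)%:Z - (r t * k)%:Z)%R.
have zJ m : z ^+ m ^ h = z ^+ m by rewrite /conjg -(commuteXz z_central) mulKg.
rewrite expgz_sub expgnDr !expgnA x_r !conjMg conjVg !zJ.
by apply: (mulIg (z ^+ k)); rewrite mulgVK gE.
Qed.

Lemma degree_hom : exists d : G -> int,
  [/\ {morph d : g h / g * h >-> (g + h)%R},
      d (x TorusX) = r TorusY & d (x TorusY) = r TorusX].
Proof.
(* The additive group of integers is viewed multiplicatively to serve as target; both sides of the
   relation have degree [r TorusX] times [r TorusY]. *)
pose H := Algebra.to_multiplicative int.
have HX (g : H) n : g ^+ n = (n%:Z * (g : int))%R.
  elim: n => [|n IH]; first by rewrite GRing.mul0r.
  by rewrite expgS IH intS GRing.mulrDl GRing.mul1r.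
pose gen' t : H := Posz (if t is TorusX then r TorusY else r TorusX).
have relP (w1 w2 : word torus_gen) : torus_rel (r TorusX) (r TorusY) w1 w2 ->
    word_eval gen' w1 = word_eval gen' w2.
  by case=> -> ->; rewrite !word_eval_nseq !HX GRing.mulrC.
have [d dM dx] := presentation_hom x_pres relP.
by exists d; split=> //; rewrite dx.
Qed.

(** Inverting both generators preserves the relation, and applying the map twice fixes them. *)
Lemma inversion_hom : exists f : G -> G,
  [/\ {morph f : g h / g * h}, involutive f & forall t, f (x t) = (x t)^-1].
Proof.
have relP (w1 w2 : word torus_gen) : torus_rel (r TorusX) (r TorusY) w1 w2 ->
    word_eval (fun t => (x t)^-1) w1 = word_eval (fun t => (x t)^-1) w2.
  by case=> -> ->; rewrite !word_eval_nseq !expVgn !x_r.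
have [f fM fx] := presentation_hom x_pres relP; exists f; split=> // g.
have [w <-] := x_pres.1 g; rewrite !morph_word_eval //.
by apply: eq_word_eval => t /=; rewrite fx morph_groupV // fx invgK.
Qed.

Lemma sign_automorphism (m : int) : m = 1%R \/ m = (- 1)%R ->
  exists f : G -> G, [/\ {morph f : g h / g * h}, bijective f &
    forall t (n : nat), f (expgz (x t) (m * n%:Z)%R) = x t ^+ n].
Proof.
case=> ->.
  by exists id; split=> // [|t n]; [exists id | rewrite GRing.mul1r].
have [f [fM fI fx]] := inversion_hom; exists f; split=> // [|t n].
  by exists f.
rewrite GRing.mulN1r -GRing.sub0r expgz_sub mul1g morph_groupV //.
by rewrite morph_groupX // fx expVgn invgK.
Qed.

(** The ambiguity modulo [z] disappears because [z] is a power of a. *)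
Lemma conj_generators_expgz c :
    (forall g, exists w, g = word_eval
       (fun i => if i is TorusX then x TorusX else x TorusY ^ c) w) ->
  exists i j : int, c = expgz (x TorusY) i * expgz (x TorusX) j.
Proof.
case/conj_generators => i [j [k [l cE]]].
exists (Posz i), ((j + r TorusX * l)%:Z - (r TorusX * k)%:Z)%R.
rewrite expgz_sub expgnDr !expgnA !mulgA.
by apply: (mulIg (z ^+ k)); rewrite cE mulgVK.
Qed.

End TorusKnotGroup.

(** * Degrees of integer powers, and the normalization of an epimorphism *)

Lemma morph_expgz (G : groupType) (d : G -> int) :
    {morph d : g h / g * h >-> (g + h)%R} ->
  forall g e, d (expgz g e) = (e * d g)%R.
Proof.
move=> dM; have d1 : d 1 = 0%R.
  by apply: (@GRing.addrI _ (d 1)); rewrite -dM mulg1 GRing.addr0.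
have dX g n : d (g ^+ n) = (n%:Z * d g)%R.
  elim: n => [|n IH]; first by rewrite GRing.mul0r.
  by rewrite expgS dM IH intS GRing.mulrDl GRing.mul1r.
move=> g [n | n] /=; first exact: dX.
apply: (@GRing.addrI _ (d (g ^+ n.+1))).
by rewrite -dM mulgV d1 dX NegzE GRing.mulNr GRing.subrr.
Qed.

Theorem proposition2p5
  (p1 p2 r1 r2 n1 n2 : nat)
  (piK piK' : groupType) (u v : piK) (a b : piK')
  (hk : is_torus_knot_type p1 p2) (hk' : is_torus_knot_type r1 r2)
  (huv : torus_knot_presentation p1 p2 u v)
  (hab : torus_knot_presentation r1 r2 a b)
  (hr1 : (r1 %| p1)%N) (hr2 : (r2 %| p2)%N)
  (hn1 : (n1 * r1)%N = p1) (hn2 : (n2 * r2)%N = p2)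
  (phi : {multiplicative piK -> piK'}) (phi_epi : surjective phi) :
  exists (alpha : {multiplicative piK' -> piK'}) (s t : int) (c : piK'),
    [/\ bijective alpha,
        c = expgz b s * expgz a t,
        alpha (phi u) = a ^+ n2 &
        alpha (phi v) = c^-1 * b ^+ n1 * c].
Proof.
have [p1_gt1 p2_gt1 p_coprime] := hk; have [r1_gt1 r2_gt1 r_coprime] := hk'.
pose r i := if i is TorusX then r1 else r2.
pose x i := match i with TorusX => a | TorusY => b end.
have r_gt1 t : 1 < r t by case: t.
have x_pres : is_presentation (torus_rel (r TorusX) (r TorusY)) x by [].
have r_gt0 t : 0 < r t by exact: ltnW.
pose UV i := match i with TorusX => phi u | TorusY => phi v end.
have UV_gen g : exists w, g = word_eval UV w.
  have [g' <-] := phi_epi g; have [w <-] := huv.1 g'; exists w.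
  rewrite (morph_word_eval (@gmulfM _ _ phi)).
  by apply: eq_word_eval => -[].
have UV_eq : phi u ^+ p1 = phi v ^+ p2.
  rewrite -!(morph_groupX (@gmulfM _ _ phi)).
  pose p i := if i is TorusX then p1 else p2.
  by rewrite [v ^+ p2](torus_gen_exp (r := p) huv TorusY).
have U_central h : commute (phi u ^+ p1) h.
  have [w ->] := UV_gen h; apply: commute_word_eval => -[] /=.
    exact/commute_sym/commuteX/commute_refl.
  by rewrite UV_eq; exact/commute_sym/commuteX/commute_refl.
have [hu [t [e UE]]] := torsion_conj r_gt1 x_pres (ltnW p1_gt1) U_central.
have [hv [t' [e' VE]]] : exists h t e, phi v = expgz (x t) e ^ h.
  by apply: (torsion_conj r_gt1 x_pres (ltnW p2_gt1)) => h; rewrite -UV_eq.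
have [d [dM da db]] := degree_hom x_pres.
have dX := morph_expgz dM.
have dJ g h : d (g ^ h) = d g.
  by apply: (@GRing.addrI _ (d h)); rewrite -dM -conjgC dM GRing.addrC.
have d_rel : (p1%:Z * d (phi u) = p2%:Z * d (phi v))%R.
  by rewrite -!dX /= UV_eq.
(* Coprimality of [p1] and [p2] gives both degrees a common factor [m]; as the two images generate,
   [m] divides every degree, in particular [r1] and [r2], hence is a unit. *)
have [m dU] : exists m : int, (d (phi u) = m * p2%:Z)%R.
  apply/dvdzP; rewrite -(@Gauss_dvdzr p2 p1).
    by rewrite d_rel dvdz_mulr.
  by rewrite coprimezE /= coprime_sym.
have dV : (d (phi v) = m * p1%:Z)%R.
  have p2_neq0 : p2%:Z%R != 0%R by rewrite eqz_nat -lt0n ltnW.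
  by apply: (GRing.mulfI p2_neq0); rewrite -d_rel dU; lia.
have m_dvd g : (m %| d g)%Z.
  have [w ->] := UV_gen g; elim: w => [|[i o] w IH].
    by rewrite word_eval_nil (dX 1 0) GRing.mul0r dvdz0.
  have m_dvd i' : (m %| d (UV i'))%Z by case: i'; rewrite /= ?dU ?dV dvdz_mulr.
  rewrite word_eval_cons dM; apply: GRing.rpredD IH; case: o => //=.
  by rewrite (dX (UV i) (- 1)%R) dvdz_mull.
have m_unit : m = 1%R \/ m = (- 1)%R.
  have : (m %| gcdz r1 r2)%Z by rewrite dvdz_gcd -{1}db -da !m_dvd.
  move: r_coprime; rewrite /coprime /gcdz /= => /eqP ->; rewrite dvdz1; lia.
(* This excludes the wrong factor: if [phi u] were conjugate to a power of b, its degree would be a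
   multiple of [r1], forcing [r1] to divide [p2]. The next fact does the same for [phi v]. *)
have r1p2 : ~~ (r1 %| p2).
  apply: contraL r1_gt1 => r1p2; rewrite -leqNgt -(eqP p_coprime).
  by apply: dvdn_leq; rewrite ?gcdn_gt0 ?(ltnW p1_gt1) // dvdn_gcd hr1.
have r2p1 : ~~ (r2 %| p1).
  apply: contraL r2_gt1 => r2p1; rewrite -leqNgt -(eqP p_coprime).
  by apply: dvdn_leq; rewrite ?gcdn_gt0 ?(ltnW p1_gt1) // dvdn_gcd hr2 r2p1.
have m_unit_dvd k l (f : int) : (f * l%:Z = m * k%:Z)%R -> l %| k.
  move=> fE; have : (l %| (m * k%:Z)%R)%Z by rewrite -fE dvdz_mull.
  by case: m_unit => ->;
    rewrite ?GRing.mul1r ?GRing.mulN1r dvdzE ?abszN !absz_nat.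
(* Cancelling [r2], the degree of a, from the degree of [phi u] determines the exponent. *)
have {dU t} UE : phi u = expgz a (m * n2%:Z)%R ^ hu.
  move: dU; rewrite UE dJ dX; case: t UE => /= UE.
    rewrite da -hn2 PoszM GRing.mulrA => /GRing.mulIf -> //.
    by rewrite eqz_nat -lt0n ltnW.
  by rewrite db => /m_unit_dvd; rewrite (negPf r1p2).
have {dV t'} VE : phi v = expgz b (m * n1%:Z)%R ^ hv.
  move: dV; rewrite VE dJ dX; case: t' VE => /= VE.
    by rewrite da => /m_unit_dvd; rewrite (negPf r2p1).
  rewrite db -hn1 PoszM GRing.mulrA => /GRing.mulIf -> //.
  by rewrite eqz_nat -lt0n ltnW.
have [f [fM [f' fK f'K] fx]] := sign_automorphism x_pres m_unit.
(* Conjugation by the inverse of [hu] frees the image of u from its conjugator, and [f] then removes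
   the sign [m]. *)
pose alpha g := f (g ^ hu^-1).
have alphaM : {morph alpha : g h / g * h}.
  by move=> g h; rewrite /alpha conjMg fM.
pose c0 := f (hv * hu^-1).
have alphaU : alpha (phi u) = a ^+ n2 by rewrite /alpha UE conjgK (fx TorusX).
have alphaV : alpha (phi v) = (b ^+ n1) ^ c0.
  rewrite /alpha VE -conjgM /c0 /conjg !fM (morph_groupV fM) fM.
  by rewrite (fx TorusY).
have alpha_bij : bijective alpha.
  exists (fun g => f' g ^ hu) => g; rewrite /alpha; last by rewrite conjgK f'K.
  by rewrite fK conjgKV.
(* [alpha] after [phi] is onto, so the powers of a and of the conjugate of b that are its values on
   u and v generate; so do a and that conjugate. *)
have c0_gen g : exists w, g = word_eval
    (fun i => if i is TorusX then x TorusX else x TorusY ^ c0) w.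
  have [g' g'K gK'] := alpha_bij; have [w wE] := UV_gen (g' g).
  rewrite -(gK' g) wE (morph_word_eval alphaM).
  apply: word_eval_subst => -[] /=.
    by exists (nseq n2 (TorusX, false)); rewrite word_eval_nseq alphaU.
  by exists (nseq n1 (TorusY, false)); rewrite word_eval_nseq alphaV conjXg.
have [s [t c0E]] := conj_generators_expgz r_gt1 x_pres c0_gen.
pose A : {multiplicative piK' -> piK'} :=
  HB.pack alpha (isMultiplicative.Build _ _ alpha alphaM).
exists A, s, t, c0; split=> //.
by rewrite -mulgA; exact: alphaV.
Qed.
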